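(* Let $n\ge1$ and $R\subseteq\{1,\dots,n-1\}$. (a) For every $k\ge1$, $$F_{n,R}\!\left[\frac{1}{(1-q_1)\cdots(1-q_k)}\right]=\frac{\sum_{\vec{\sigma}\in S_n^{\times(k-1)}}q_1^{\mathrm{comaj}^1_R(\vec\sigma)}\cdots q_k^{\mathrm{comaj}^k_R(\vec\sigma)}}{(q_1;q_1)_n\cdots(q_k;q_k)_n}.$$ (b) In the infinite case, $$F_{n,R}\!\left[\frac{1}{(1-q_1)(1-q_2)\cdots}\right]=\frac{\sum_{\vec\sigma\in{}_RS_n^\infty}Q^{\mathrm{Comaj}_R(\vec\sigma)}}{(q_1;q_1)_n(q_2;q_2)_n\cdots}.$$
   Context: $\mathbb{N}=\{0,1,\dots\}$; sequences in $\mathbb{N}^r$ (and finitely supported sequences in $\mathbb{N}^\infty$) are compared lexicographically, the first coordinate being most significant. $(q;t)_r=(1-q)(1-qt)\cdots(1-qt^{r-1})$; $\epsilon$ is the identity of $S_n$. Gessel's fundamental quasisymmetric function is $F_{n,R}=\sum x_{a_1}\cdots x_{a_n}$ over $a_1\le\cdots\le a_n$ with $a_i<a_{i+1}$ for $i\in R$. By definition here, $F_{n,R}[1/((1-q_1)\cdots(1-q_k))]=\sum q^S$ over $S=(s^1,\dots,s^n)\in(\mathbb{N}^k)^n$ with $s^1\le\cdots\le s^n$ and $s^i<s^{i+1}$ for $i\in R$, where $q^S=\prod_{i=1}^k q_i^{\sum_j s^j_{k-i+1}}$; and $F_{n,R}[1/((1-q_1)(1-q_2)\cdots)]=\sum Q^Z$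 over $Z=(z^1,\dots,z^n)$ of finitely supported sequences in $\mathbb{N}^\infty$ with $z^1\le\cdots\le z^n$ and $z^i<z^{i+1}$ for $i\in R$, where $Q^Z=\prod_{i\ge1}q_i^{\sum_j z^j_i}$. For distinct $a,b$, $a\sim_R b$ if all of $\min(a,b),\dots,\max(a,b)-1$ lie in $R$. For $S\in(\mathbb{N}^r)^n$ (if $r=0$ all $s^i$ empty and equal) and $\sigma\in S_n$, $\mathrm{Des}_{R,S}(\sigma)$ is the set of $i\in\{1,\dots,n-1\}$ with either $s^{\sigma_i}>s^{\sigma_{i+1}}$, or $s^{\sigma_i}=s^{\sigma_{i+1}}$ and either ($\sigma_{i+1}<\sigma_i$ and not $\sigma_{i+1}\sim_R\sigma_i$) or ($\sigma_{i+1}>\sigma_i$ and $\sigma_i\sim_R\sigma_{i+1}$). $\mathrm{Comaj}_{R,S}(\sigma)=\sum_{i\in\mathrm{Des}_{R,S}(\sigma)}(n-i)$. $Z_{R,\sigma}(S)\in(\mathbb{N}^{r+1})^n$ prepends to each $s^j$ a first coordinate $z^j_1$ with $z^{\sigma_i}_1=\#\{j<i:j\in\mathrm{Des}_{R,S}(\sigma)\}$. For $\vec\pi=(\pi^1,\dots,\pi^{k-1})\in S_n^{\times(k-1)}$, set $\pi^k=\epsilon$, $Z^0=$ list of $n$ empty sequences, $Z^i=Z_{R,\pi^i}(Z^{i-1})$, and $\mathrm{comaj}^i_R(\vec\pi)=\mathrm{Comaj}_{R,Z^{i-1}}(\pi^i)$, $1\le i\le k$. Let $\tau_R\in S_n$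 be the unique permutation with $\mathrm{Comaj}_{R,\emptyset}(\tau_R)=0$ ($\emptyset$ = list of $n$ empty sequences). ${}_RS_n^\infty$ is the set of sequences $(\sigma^1,\sigma^2,\dots)$ in $S_n$ with $\sigma^1=\epsilon$ and $\sigma^i=\tau_R$ for all large $i$; for such $\vec\sigma$ let $m\ge1$ be smallest with $\sigma^i=\tau_R$ for all $i>m$, and $Q^{\mathrm{Comaj}_R(\vec\sigma)}=\prod_{j=1}^m q_j^{\mathrm{comaj}^{m-j+1}_R(\sigma^m,\dots,\sigma^2)}$ (the tuple $(\sigma^m,\dots,\sigma^2)$ has length $m-1$). *)

(* Defs.v *)
(* Formal power series identities are stated coefficientwise,
   after clearing the (invertible) denominators. *)
From HB Require Import structures.
From mathcomp Require Import all_boot all_order all_algebra all_fingroup.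
From Stdlib Require List.

Unset Printing Implicit Defensive.
Import GRing.Theory.

Fixpoint tuples (T : Type) (n : nat) (A : seq T) : seq (seq T) :=
  if n is n'.+1 then [seq x :: s | x <- A, s <- tuples T n' A] else [:: [::]].

Definition vecs (r B : nat) : seq (seq nat) := tuples nat r (iota 0 B.+1).

Fixpoint boxes (e : seq nat) : seq (seq nat) :=
  if e is x :: e' then [seq y :: a | y <- iota 0 x.+1, a <- boxes e'] else [:: [::]].

Fixpoint lexlt (s t : seq nat) : bool :=
  match s, t with
  | x :: s', y :: t' => (x < y) || ((x == y) && lexlt s' t')
  | _, _ => false
  end.
Definition lexle (s t : seq nat) : bool := (s == t) || lexlt s t.

Definition Fchain (R : seq nat) (S : seq (seq nat)) : bool :=
  all (fun i => if i \in R then lexlt (nth [::] S i.-1) (nth [::] S i)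
                else lexle (nth [::] S i.-1) (nth [::] S i))
      (iota 1 (size S).-1).

(* exponent vector of q^S (position i-1 = exponent of q_i) *)
Definition weightA (k : nat) (S : seq (seq nat)) : seq nat :=
  [seq \sum_(s <- S) nth 0 s (k - i) | i <- iota 1 k].

(* coefficient of q^e in F_{n,R}[1/((1-q_1)...(1-q_k))]  (size e = k);
   every such S has all entries <= sumn e *)
Definition lhsA (n k : nat) (R : seq nat) (e : seq nat) : nat :=
  count (fun S => Fchain R S && (weightA k S == e)) (tuples (seq nat) n (vecs k (sumn e))).

(* exponent vector of Q^Z truncated to the first N variables *)
Definition weightInf (N : nat) (Z : seq (seq nat)) : seq nat :=
  [seq \sum_(z <- Z) nth 0 z i | i <- iota 0 N].

(* coefficient of Q^e (e_i = exponent of q_{i+1}) in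
   F_{n,R}[1/((1-q_1)(1-q_2)...)]; every Z with Q^Z = Q^e has each z^j
   supported in the first size e coordinates with entries <= sumn e,
   so Z is encoded by these prefixes (lex order preserved). *)
Definition lhsB (n : nat) (R : seq nat) (e : seq nat) : nat :=
  count (fun Z => Fchain R Z && (weightInf (size e) Z == e))
        (tuples (seq nat) n (vecs (size e) (sumn e))).

Local Open Scope ring_scope.
Definition qpoch (T : comNzRingType) (q t : T) (r : nat) : T :=
  \prod_(i < r) (1 - q * t ^+ i).

Definition qqn (n : nat) : {poly int} := qpoch {poly int} 'X 'X n.

(* coefficient of q^a in prod_i (q_i;q_i)_n  (finitely or infinitely many i:
   the factors for variables outside the support contribute their constant
   coefficient 1) *)
Definition dencoef (n : nat) (a : seq nat) : int := \prod_(x <- a) (qqn n)`_x.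

(* coefficient of q^e in (prod_i (q_i;q_i)_n) * L where L has coefficients L *)
Definition conv (n : nat) (e : seq nat) (L : seq nat -> nat) : int :=
  \sum_(a <- boxes e) dencoef n a * (L [seq (x.1 - x.2)%N | x <- zip e a])%:Z.

Local Close Scope ring_scope.

Definition simR (R : seq nat) (a b : nat) : bool :=
  (a != b) && all (fun j => j \in R) (iota (minn a b) (maxn a b - minn a b)).

(* sigma_i, 1-indexed, with values in {1..n} *)
Definition pval (n : nat) (s : 'S_n) (i : nat) : nat :=
  nth 0 [seq (s x).+1 | x <- enum 'I_n] i.-1.

Definition Des (n : nat) (R : seq nat) (S : seq (seq nat)) (s : 'S_n) : seq nat :=
  [seq i <- iota 1 n.-1 |
    let a := pval n s i in let b := pval n s i.+1 in
    let sa := nth [::] S a.-1 in let sb := nth [::] S b.-1 in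
    lexlt sb sa ||
    ((sa == sb) && (((b < a) && ~~ simR R b a) || ((a < b) && simR R a b)))].

Definition Comaj (n : nat) (R : seq nat) (S : seq (seq nat)) (s : 'S_n) : nat :=
  \sum_(i <- Des n R S s) (n - i).

Definition Zmap (n : nat) (R : seq nat) (s : 'S_n) (S : seq (seq nat)) :
  seq (seq nat) :=
  let D := Des n R S s in
  [seq count (fun d => d < pval n s^-1 j) D :: nth [::] S j.-1 | j <- iota 1 n].

Fixpoint comaj_aux (n : nat) (R : seq nat) (Z : seq (seq nat)) (ps : seq 'S_n)
  : seq nat :=
  if ps is p :: ps' then Comaj n R Z p :: comaj_aux n R (Zmap n R p Z) ps' else [::].

(* [comaj^1_R(pi); ...; comaj^k_R(pi)] for pi = (pi^1,...,pi^{k-1}) *)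
Definition comajs (n : nat) (R : seq nat) (pis : seq 'S_n) : seq nat :=
  comaj_aux n R (nseq n [::]) (rcons pis 1%g).

(* coefficient of q^e in the numerator of (a) ; S_n^{x(k-1)} as lists *)
Definition numA (n k : nat) (R : seq nat) (e : seq nat) : nat :=
  count (fun pis => comajs n R pis == e) (tuples 'S_n k.-1 (enum 'S_n)).

(* tau_R : the unique permutation with Comaj_{R,emptyset} = 0 *)
Definition tauR (n : nat) (R : seq nat) : 'S_n :=
  odflt 1%g [pick t : 'S_n | Comaj n R (nseq n [::]) t == 0].

(* sequences (sigma^1, sigma^2, ...) are functions s with sigma^i = s (i-1) *)
Definition RSinf (n : nat) (R : seq nat) (s : nat -> 'S_n) : Prop :=
  s 0 = 1%g /\ exists M, forall i, M <= i -> s i = tauR n R.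

Definition isM (n : nat) (R : seq nat) (s : nat -> 'S_n) (m : nat) : Prop :=
  1 <= m /\ (forall j, m <= j -> s j = tauR n R) /\
  (forall m', 1 <= m' -> (forall j, m' <= j -> s j = tauR n R) -> m <= m').

(* exponent vector of Q^{Comaj_R(sigma)} : position j-1 = exponent of q_j *)
Definition ComajExp (n : nat) (R : seq nat) (s : nat -> 'S_n) (m : nat)
  : seq nat :=
  let c := comajs n R (rev [seq s i | i <- iota 1 m.-1]) in
  [seq nth 0 c (m - j) | j <- iota 1 m].

(* equality of monomials given by (finitely supported) exponent lists *)
Definition monoeq (a b : seq nat) : bool :=
  all (fun i => nth 0 a i == nth 0 b i) (iota 0 (maxn (size a) (size b))).

Definition fiberB (n : nat) (R : seq nat) (e : seq nat) (s : nat -> 'S_n) : Prop :=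
  RSinf n R s /\ exists m, isM n R s m /\ monoeq (ComajExp n R s m) e.

(* Main.v *)
(** Order the labels [1..n] of [S] lexicographically by [S], breaking ties by
    decreasing label inside a [~_R]-class and increasing label across classes.
    Exactly one permutation [r] lists the labels in this order, and
    [Des_{R,S}(s)] is the ordinary descent set of [s * r^-1]; in particular
    [Des_{R,S}(s)] is empty iff [s = r].  Prepending a coordinate [z] to [S]
    produces a list sorted by [s] iff
    [z_{s_i} + [i in Des_{R,S}(s)] <= z_{s_{i+1}}] for all [i], so that [z] is a
    partition with at most [n] parts shifted by the descent counts, whence the
    generating function [q^Comaj / (q;q)_n].  Adding coordinates one at a time,
    both sides count paths of permutations weighted by relative comajor indices,
    from [tau_R] to the identity.  In the infinite case a zero exponent forces
    two consecutive permutations to agree, so these paths are finite. *)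
Require Import Defs.
From HB Require Import structures.
From mathcomp Require Import all_boot all_order all_algebra all_fingroup.
From mathcomp Require Import zify.
From Stdlib Require List.
From Stdlib Require Import FunctionalExtensionality.

(* [perm] also exports a [pval]. *)
Import Defs.

Set Implicit Arguments.
Unset Strict Implicit.

(** * Sorting the labels *)

Lemma lexlt_irr s : lexlt s s = false.
Proof. by elim: s => //= x s ->; rewrite ltnn eqxx. Qed.

Lemma lexlt_trans s t u : lexlt s t -> lexlt t u -> lexlt s u.
Proof.
elim: s t u => [|x s IH] [|y t] [|z u] //=.
case/orP=> [xy|/andP[/eqP-> st]]; case/orP=> [yz|/andP[/eqP<- tu]].
- by rewrite (ltn_trans xy yz).
- by rewrite xy.
- by rewrite yz.
- by rewrite eqxx (IH _ _ st tu) orbT.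
Qed.

Lemma lexlt_total s t : size s = size t -> s != t -> lexlt s t || lexlt t s.
Proof.
elim: s t => [|x s IH] [|y t] //= [sz]; rewrite eqseq_cons.
by case: (ltngtP x y) => //= _ ne; apply: IH.
Qed.

(* The classes of [~_R] are the level sets of this nondecreasing function. *)
Definition simclass (R : seq nat) (a : nat) := count [predC R] (iota 0 a).

Definition tie (R : seq nat) (a b : nat) : bool :=
  ((a < b) && ~~ simR R a b) || ((b < a) && simR R b a).

Lemma simclass_leq R a b : a <= b -> simclass R a <= simclass R b.
Proof. by move=> ab; rewrite /simclass -(subnKC ab) iotaD count_cat leq_addr. Qed.

Lemma simR_class R a b : a < b -> simR R a b = (simclass R a == simclass R b).
Proof.
move=> ab; rewrite /simR /simclass neq_ltn ab /=.
rewrite (minn_idPl (ltnW ab)) (maxn_idPr (ltnW ab)).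
rewrite -[in iota 0 b](subnKC (ltnW ab)) iotaD count_cat add0n.
rewrite -[X in X == _]addn0 eqn_add2l eq_sym -leqn0 leqNgt -has_count has_predC negbK.
by apply: eq_all.
Qed.

(** Read on pairs (class, label), [tie] is lexicographic with the label reversed; this makes it a
    strict total order and reduces transitivity to arithmetic. *)
Lemma tieE R a b : tie R a b =
  (simclass R a < simclass R b) || ((simclass R a == simclass R b) && (b < a)).
Proof.
rewrite /tie; case: (ltngtP a b) => [ab|ba|->] /=.
- by rewrite (simR_class R ab) orbF andbF orbF ltn_neqAle simclass_leq ?andbT // ltnW.
- rewrite (simR_class R ba) andbT eq_sym orbC.
  by rewrite [simclass R a < _]ltnNge simclass_leq ?orbF // ltnW.
- by rewrite ltnn andbF.
Qed.

Definition bef (R : seq nat) (S : seq (seq nat)) (a b : nat) : bool :=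
  let sa := nth [::] S a.-1 in let sb := nth [::] S b.-1 in
  lexlt sa sb || ((sa == sb) && tie R a b).

Lemma bef_irr R S a : bef R S a a = false.
Proof. by rewrite /bef lexlt_irr tieE !ltnn !andbF. Qed.

Lemma bef_trans R S b a c : bef R S a b -> bef R S b c -> bef R S a c.
Proof.
rewrite /bef; case/orP=> [ab|/andP[/eqP ab tab]]; case/orP=> [bc|/andP[/eqP bc tbc]].
- by rewrite (lexlt_trans ab bc).
- by rewrite -bc ab.
- by rewrite ab bc.
- by apply/orP; right; rewrite ab bc eqxx /=; move: tab tbc; rewrite !tieE; lia.
Qed.

Lemma bef_total R S k a b : all (fun s => size s == k) S ->
  0 < a <= size S -> 0 < b <= size S -> a != b -> bef R S a b || bef R S b a.
Proof.
move=> /(all_nthP [::]) sz ha hb ab; rewrite /bef /=.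
have [e|ne] := eqVneq (nth [::] S a.-1) (nth [::] S b.-1).
  by rewrite e lexlt_irr /= !tieE; lia.
rewrite /= !orbF; apply: lexlt_total => //.
by rewrite (eqP (sz _ _)) ?(eqP (sz _ _)) //; lia.
Qed.

(** * Linear orders and permutations *)

Lemma linear_order_rank n (r : rel 'I_n) :
  irreflexive r -> transitive r -> (forall a b, a != b -> r a b || r b a) ->
  exists t : 'S_n, forall a b, r a b = (t a < t b).
Proof.
move=> irr tr tot.
(* The rank of an element is its number of predecessors; it grows strictly along [r], hence is
   injective because [r] is total. *)
have ltr a b : r a b -> #|[pred c | r c a]| < #|[pred c | r c b]|.
  move=> ab; apply: proper_card; apply/properP; split.
    by apply/subsetP => c; rewrite !inE => ca; apply: tr ca ab.
  by exists a; rewrite !inE ?irr.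
have rk_lt a : #|[pred c | r c a]| < n.
  rewrite -[X in _ < X]card_ord; apply: proper_card; apply/properP; split.
    exact/subsetP.
  by exists a; rewrite !inE ?irr.
have rk_inj : injective (fun a => Ordinal (rk_lt a)).
  move=> a b /(congr1 val)/= e; apply/eqP/negPn/negP => /tot/orP[] /ltr; 
  by rewrite e ltnn.
exists (perm rk_inj) => a b; rewrite !permE /=.
apply/idP/idP => [/ltr //|]; have [->|/tot/orP[//|/ltr]] := eqVneq a b.
  by rewrite ltnn.
by move=> /ltnW; rewrite leqNgt => /negbTE ->.
Qed.

Lemma increasing_perm1 n (s : 'S_n) :
  (forall i j : 'I_n, j = i.+1 :> nat -> s i < s j) -> s = 1%g.
Proof.
move=> inc.
have mono (i j : 'I_n) : i < j -> s i < s j.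
  case: j => j ltj /= /subnKC; move: (j - i.+1) => d; elim: d j ltj => [|d IH] j ltj e.
    by apply: inc => /=; lia.
  have ltj' : j.-1 < n by lia.
  apply: ltn_trans (IH _ ltj' _) (inc _ _ _) => /=; lia.
have ge (t : 'S_n) : (forall i j : 'I_n, i < j -> t i < t j) -> forall i : 'I_n, i <= t i.
  move=> tm [i lti]; elim: i lti => [|i IH] lti //=.
  by apply: leq_ltn_trans (IH (ltnW lti)) (tm _ _ _) => /=.
apply/permP => i; rewrite perm1; apply: val_inj; apply/eqP.
rewrite eqn_leq ge // andbT.
(* An increasing permutation satisfies [i <= s i]; the same bound for the inverse, taken at [s i],
   gives the opposite inequality. *)
suff: s i <= (s^-1)%g (s i) by rewrite permK.
apply: ge => a b ab; rewrite ltnNge leq_eqVlt; apply/norP; split.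
  by rewrite val_eqE (inj_eq perm_inj) -val_eqE neq_ltn ab orbT.
by apply/negP => /mono; rewrite !permKV ltnNge ltnW.
Qed.

(** * Permutations as words and their descents *)

Lemma pval_ord n (s : 'S_n) (i : 'I_n) : pval n s i.+1 = (s i).+1.
Proof. by rewrite /pval /= (nth_map i) ?size_enum_ord // nth_ord_enum. Qed.

Lemma label_ord n i : 0 < i <= n -> exists x : 'I_n, i = x.+1.
Proof. by case: i => // i lti; exists (Ordinal (lti : i < n)). Qed.

Lemma pval_range n (s : 'S_n) i : 0 < i <= n -> 0 < pval n s i <= n.
Proof. by case/label_ord => x ->; rewrite pval_ord /= ltn_ord. Qed.

Lemma pvalM n (s t : 'S_n) i : 0 < i <= n -> pval n (s * t)%g i = pval n t (pval n s i).
Proof. by case/label_ord => x ->; rewrite !pval_ord permM. Qed.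

Lemma pval1 n i : 0 < i <= n -> pval n 1%g i = i.
Proof. by case/label_ord => x ->; rewrite pval_ord perm1. Qed.

Lemma pvalK n (s : 'S_n) i : 0 < i <= n -> pval n s^-1%g (pval n s i) = i.
Proof. by move=> hi; rewrite -pvalM // mulgV pval1. Qed.

Lemma pvalKV n (s : 'S_n) i : 0 < i <= n -> pval n s (pval n s^-1%g i) = i.
Proof. by move=> hi; rewrite -pvalM // mulVg pval1. Qed.

(* Descents of [s] when the labels are ordered as listed by [r]. *)
Definition rdes n (r s : 'S_n) : seq nat :=
  [seq i <- iota 1 n.-1 | pval n (s * r^-1)%g i.+1 < pval n (s * r^-1)%g i].

Definition rcomaj n (r s : 'S_n) : nat := \sum_(i <- rdes r s) (n - i).

(** The clauses defining [Des] say that the label listed at [i.+1] ought to precede the one listed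
    at [i]. *)
Lemma DesE n R S (s : 'S_n) :
  Des n R S s = [seq i <- iota 1 n.-1 | bef R S (pval n s i.+1) (pval n s i)].
Proof.
by apply: eq_filter => i; rewrite /bef /tie /= [_ == nth _ _ (pval n s i).-1]eq_sym.
Qed.

Lemma filter_nilP (a : pred nat) s : reflect {in s, forall i, ~~ a i} (filter a s == [::]).
Proof.
rewrite -size_eq0 size_filter -leqn0 leqNgt -has_count; apply: hasPn.
Qed.

(** Products act from left to right, so [s * r^-1] lists the positions in [r] of the letters of [s];
    without descents it is increasing, hence the identity. *)
Lemma rdes_nil n (r s : 'S_n) : (rdes r s == [::]) = (s == r).
Proof.
apply/filter_nilP/eqP => [h|-> i]; last first.
  by rewrite mem_iota mulgV => hi; rewrite !pval1; lia.
suff e : (s * r^-1)%g = 1%g by rewrite -[s](mulgKV r) e mul1g.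
apply: increasing_perm1 => i j ji.
have := h i.+1; rewrite mem_iota -{3}ji !pval_ord -leqNgt ltnS => hj.
have : (s * r^-1)%g i != (s * r^-1)%g j by rewrite (inj_eq perm_inj) -val_eqE /= neq_ltn ji leqnn.
rewrite -val_eqE /= => ne; rewrite ltn_neqAle ne /=; apply: hj.
by have := ltn_ord j; lia.
Qed.

Lemma Des_rdes n R S k : size S = n -> all (fun s => size s == k) S ->
  exists r : 'S_n, forall s, Des n R S s = rdes r s.
Proof.
move=> szS szk.
have [|||r rP] := @linear_order_rank n (fun a b => bef R S a.+1 b.+1).
- by move=> a; apply: bef_irr.
- by move=> b a c; apply: bef_trans.
- move=> a b ab; apply: (@bef_total R S k) => //; rewrite ?szS ?ltn_ord //.
(* The permutation obtained maps labels to ranks; its inverse lists the labels in order. *)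
exists r^-1%g => s; rewrite DesE /rdes invgK; apply: eq_in_filter => i.
rewrite mem_iota => hi; rewrite !pvalM; try lia.
have [|x ex] := @label_ord n i; first lia.
have [|y ey] := @label_ord n i.+1; first lia.
by rewrite ex -ex ey {}ex !pval_ord rP /= !ltnS.
Qed.

(** * Prepending one coordinate *)

Definition addcol (z : seq nat) (S : seq (seq nat)) := [seq x.1 :: x.2 | x <- zip z S].

Lemma nth_addcol z S i : i < size z -> size z = size S ->
  nth [::] (addcol z S) i = nth 0 z i :: nth [::] S i.
Proof.
by move=> hi sz; rewrite (nth_map (0, [::])) ?size_zip ?nth_zip -?sz ?minnn.
Qed.

Lemma mem_Des n R S (s : 'S_n) i : 0 < i < n ->
  (i \in Des n R S s) = bef R S (pval n s i.+1) (pval n s i).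
Proof. by move=> hi; rewrite DesE mem_filter mem_iota andbC; case: (_ && _) / idP; lia. Qed.

Lemma Des_addcol_nil n R (s : 'S_n) z S : size z = n -> size S = n ->
  (Des n R (addcol z S) s == [::]) =
  all (fun i => nth 0 z (pval n s i).-1 + (i \in Des n R S s)
                  <= nth 0 z (pval n s i.+1).-1) (iota 1 n.-1).
Proof.
move=> sz sS.
have E i : i \in iota 1 n.-1 -> ~~ bef R (addcol z S) (pval n s i.+1) (pval n s i) =
    (nth 0 z (pval n s i).-1 + (i \in Des n R S s) <= nth 0 z (pval n s i.+1).-1).
  rewrite mem_iota => hi; rewrite mem_Des; last by lia.
  have ha := @pval_range n s i; have hb := @pval_range n s i.+1.
  rewrite {1}/bef !nth_addcol ?sz ?sS //; try lia.
  (* The new coordinate decides unless it is equal at both labels; then the old rows decide, which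
     is the indicator on the left side. *)
  rewrite /bef /= eqseq_cons; case: ltngtP => /= h.
  - by apply/esym/negbTE; lia.
  - by case: (_ || _); lia.
  - by rewrite h; case: (_ || _); lia.
rewrite DesE; apply/filter_nilP/allP => h i hi; first by rewrite -E // h.
by rewrite E // h.
Qed.

(* Partitions of [y] into parts of size at most [n]; [u] is the multiplicity of [n]. *)
Fixpoint npart (n y : nat) : nat :=
  if n is n'.+1 then
    \sum_(u < y.+1) (if n * u <= y then npart n' (y - n * u) else 0)
  else y == 0.

(** The coefficient of q^x in q^c/(q;q)_n. *)
Definition shift_npart (n c x : nat) : nat := if c <= x then npart n (x - c) else 0.

(** Summands beyond [y] vanish, so the range may be chosen freely when two such sums are
    compared. *)
Lemma npartS n y M : y <= M ->
  npart n.+1 y = \sum_(0 <= u < M.+1) shift_npart n (n.+1 * u) y.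
Proof.
move=> yM; rewrite /= -(big_mkord xpredT (fun u => shift_npart n (n.+1 * u) y)).
rewrite [RHS](big_cat_nat (n := y.+1)) //=.
have -> : \sum_(y.+1 <= u < M.+1) shift_npart n (n.+1 * u) y = 0; last by rewrite addn0.
rewrite big_nat_cond big1 // => u; rewrite andbT => /andP[yu _].
by rewrite /shift_npart leqNgt; case: ltnP => //; nia.
Qed.

(** Either no part equals [n.+1] or one such part can be removed; this is the factor 1 - q^(n+1) of
    the denominator. *)
Lemma npart_rec n y :
  npart n.+1 y = npart n y + (if n.+1 <= y then npart n.+1 (y - n.+1) else 0).
Proof.
rewrite (@npartS n y y) // big_nat_recl //= muln0 {1}/shift_npart subn0; congr (_ + _).
rewrite -/(npart n.+1 (y - n.+1)).
case: (leqP n.+1 y) => h; last first.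
  by rewrite big_nat_cond big1 // => u _; rewrite /shift_npart leqNgt mulnS ltn_addr.
case: y h => // y h; rewrite (@npartS n _ y); last by lia.
apply: eq_big_nat => u _; rewrite /shift_npart mulnS.
have -> : (n.+1 + n.+1 * u <= y.+1) = (n.+1 * u <= y.+1 - n.+1) by lia.
by case: leqP => // ?; rewrite subnDA.
Qed.

(** * Sequences with prescribed minimal increments *)

Fixpoint steps (v : nat) (d w : seq nat) : bool :=
  match d, w with
  | x :: d', u :: w' => (v + x <= u) && steps u d' w'
  | _, _ => true
  end.

(** An increment raises its own entry and all later ones, so this is the least sum of a sequence
    allowed by [steps 0 d]. *)
Fixpoint stepsum (d : seq nat) : nat :=
  if d is x :: d' then (size d) * x + stepsum d' else 0.

Lemma count_allpairs (T1 T2 T : Type) (f : T1 -> T2 -> T) A B (P : pred T) :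
  count P [seq f x y | x <- A, y <- B] = \sum_(x <- A) count (fun y => P (f x y)) B.
Proof.
elim: A => [|x A IH]; first by rewrite big_nil.
by rewrite big_cons /= count_cat count_map IH.
Qed.

Lemma count_tuplesS (T : Type) (A : seq T) k (P : pred (seq T)) :
  count P (tuples T k.+1 A) = \sum_(x <- A) count (fun s => P (x :: s)) (tuples T k A).
Proof. exact: count_allpairs. Qed.

(** Subtracting the minimal sequence leaves a nondecreasing one, whose conjugate is a partition into
    parts of size at most [size d]. Since [x <= B], the bound on the entries loses nothing. *)
Lemma count_steps d v x B : x <= B ->
  count (fun w => steps v d w && (sumn w == x)) (tuples nat (size d) (iota 0 B.+1))
  = shift_npart (size d) (stepsum d + size d * v) x.
Proof.
elim: d v x => [|y d IH] v x xB; first by rewrite /= addn0 /shift_npart mul0n /= subn0 eq_sym.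
rewrite -[size (y :: d)]/(size d).+1 count_tuplesS.
(* The number of admissible sequences with first entry [u]. *)
pose F u := if (v + y <= u) && (u <= x) then
  shift_npart (size d) (stepsum d + size d * u) (x - u) else 0.
transitivity (\sum_(0 <= u < B.+1) F u).
  rewrite /index_iota subn0; apply: eq_bigr => u _; rewrite /F.
  under eq_count => w do rewrite [steps _ _ _]/= [sumn _]/=.
  case: (leqP (v + y) u) => h1; last by elim: (tuples _ _ _).
  case: (leqP u x) => h2; last first.
    rewrite (eq_count (a2 := pred0)) ?count_pred0 // => w /=.
    by apply/negP => /andP[_ /eqP]; lia.
  rewrite -IH; last by lia.
  by apply: eq_count => w; congr (_ && _); apply/eqP/eqP; lia.
set c := stepsum _ + _.
(* [c] is the least attainable sum: the first entry is at least [v + y], and so are all others. *)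
have cE : c = stepsum d + (size d).+1 * (v + y) by rewrite /c /= ; nia.
have FE u : F u = if v + y <= u then shift_npart (size d) (stepsum d + (size d).+1 * u) x else 0.
  rewrite /F /shift_npart; case: (leqP (v + y) u) => //= h.
  case: (leqP u x) => h2; last by case: leqP => //; nia.
  have -> : (stepsum d + size d * u <= x - u) = (stepsum d + (size d).+1 * u <= x) by nia.
  by case: leqP => // h3; congr npart; nia.
rewrite /shift_npart; case: (leqP c x) => hc; last first.
  rewrite big1 // => u _; rewrite FE; case: leqP => // h; rewrite /shift_npart; case: leqP => //; nia.
rewrite (big_cat_nat (n := v + y)) //; last by nia.

rewrite big_nat_cond big1 ?add0n; last first.
  by move=> u; rewrite andbT FE => /andP[_]; rewrite ltnNge => /negbTE->.
(* The excess of the first entry over [v + y] becomes the multiplicity of the largest part in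
   [npartS]. *)
rewrite -{1}[v + y]add0n big_addn.
have -> : B.+1 - (v + y) = (B - (v + y)).+1 by nia.
rewrite (@npartS _ _ (B - (v + y))); last by nia.
apply: eq_big_nat => u _; rewrite FE leq_addl /shift_npart.
have -> : (stepsum d + (size d).+1 * (u + (v + y)) <= x) = ((size d).+1 * u <= x - c) by nia.
by case: leqP => // h; congr npart; nia.
Qed.

(** * Tuples and their relabelling *)

Lemma mem_tuples (T : eqType) n (A : seq T) s :
  (s \in tuples T n A) = (size s == n) && all [in A] s.
Proof.
elim: n s => [|n IH] [|x s] //=.
  by apply/allpairsP => -[[y t]] /= [].
apply/allpairsP/andP => [[[y t] /= [yA]]|[sz /andP[xA sA]]].
  by rewrite IH => /andP[sz tA] [-> ->]; rewrite /= eqSS sz yA tA.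
by exists (x, s); rewrite /= IH; split=> //; rewrite -eqSS sz.
Qed.

Lemma uniq_tuples (T : eqType) n (A : seq T) : uniq A -> uniq (tuples T n A).
Proof.
move=> uA; elim: n => //= n IH; apply: allpairs_uniq => // -[x s] [y t] _ _ /= [-> ->] //.
Qed.

Lemma perm_map_endo (T : eqType) (f : T -> T) s :
  uniq s -> {in s &, injective f} -> {in s, forall x, f x \in s} -> perm_eq (map f s) s.
Proof.
move=> us fi fs; have um : uniq (map f s) by rewrite map_inj_in_uniq.
apply: uniq_perm => //; have sub : {subset map f s <= s} by move=> _ /mapP[x xs ->]; apply: fs.
by have [|_ e] := uniq_min_size um sub; rewrite ?size_map // => x; rewrite e.
Qed.

(** Reading a column along [s] turns the conditions of [Des_addcol_nil] into conditions on
    neighbouring entries. *)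
Definition relabel n (s : 'S_n) (z : seq nat) : seq nat :=
  [seq nth 0 z (pval n s i.+1).-1 | i <- iota 0 n].

Lemma size_relabel n (s : 'S_n) z : size (relabel s z) = n.
Proof. by rewrite size_map size_iota. Qed.

Lemma nth_relabel n (s : 'S_n) z i : i < n ->
  nth 0 (relabel s z) i = nth 0 z (pval n s i.+1).-1.
Proof. by move=> hi; rewrite (nth_map 0) ?size_iota // nth_iota. Qed.

Lemma relabelK n (s : 'S_n) z : size z = n -> relabel s^-1%g (relabel s z) = z.
Proof.
move=> sz; apply: (@eq_from_nth _ 0); first by rewrite size_relabel.
move=> i; rewrite size_relabel => hi; rewrite nth_relabel //.
have hr := @pval_range n s^-1%g i.+1.
by rewrite nth_relabel ?prednK ?pvalKV //; lia.
Qed.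

Lemma sumn_relabel n (s : 'S_n) z : size z = n -> sumn (relabel s z) = sumn z.
Proof.
move=> sz; rewrite sumnE big_map (_ : iota 0 n = index_iota 0 n) ?big_mkord;
  last by rewrite /index_iota subn0.
rewrite sumnE (big_nth 0) sz big_mkord [RHS](reindex_inj (@perm_inj _ s)).
by apply: eq_bigr => i _; rewrite pval_ord.
Qed.

Lemma steps_iota v (f : nat -> nat) a m w : size w = m ->
  steps v [seq f i | i <- iota a m] w =
  all (fun i => nth 0 (v :: w) i + f (a + i) <= nth 0 w i) (iota 0 m).
Proof.
elim: m a v w => [|m IH] a v [|u w] //= [sz]; rewrite addn0 IH //; congr (_ && _).
rewrite (iotaDl 1 0) all_map; apply: eq_all => i /=.
by rewrite addnCA addSn addnC.
Qed.

Lemma stepsum_iota (f : nat -> nat) a m :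
  stepsum [seq f i | i <- iota a m] = \sum_(i <- iota a m) (a + m - i) * f i.
Proof.
elim: m a => [|m IH] a; first by rewrite big_nil.
rewrite [LHS]/= IH big_cons size_map size_iota addKn; congr (_ + _).
by apply: eq_bigr => i _; rewrite addSnnS.
Qed.

Lemma count_addcol n R (s : 'S_n) S x B : size S = n -> x <= B ->
  count (fun z => (Des n R (addcol z S) s == [::]) && (sumn z == x))
        (tuples nat n (iota 0 B.+1))
  = shift_npart n (Comaj n R S s) x.
Proof.
(* Index 0 is never a descent, so the first increment is 0; increment [i] has weight [n - i], which
   makes [stepsum d] the comajor index. *)
move=> sS xB; pose d := [seq (i \in Des n R S s : nat) | i <- iota 0 n].
have sd : size d = n by rewrite size_map size_iota.
have cd : stepsum d = Comaj n R S s.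
  rewrite stepsum_iota add0n /Comaj {2}/Des; clear d sd.
  case: n s sS => [|m] s sS; first by rewrite !big_nil.
  rewrite /= big_cons mem_filter mem_iota andbF muln0 add0n big_filter [RHS]big_mkcond.
  apply: eq_big_seq => i hi; rewrite mem_filter hi andbT.
  by rewrite /=; case: (_ || _); rewrite ?muln1 ?muln0.
have permw : perm_eq [seq relabel s z | z <- tuples nat n (iota 0 B.+1)]
                     (tuples nat n (iota 0 B.+1)).
  apply: perm_map_endo; first exact/uniq_tuples/iota_uniq.
    move=> z z'; rewrite !mem_tuples => /andP[/eqP sz _] /andP[/eqP sz' _] e.
    by rewrite -(relabelK s sz) e relabelK.
  move=> z; rewrite !mem_tuples size_relabel eqxx => /andP[/eqP sz /allP hz] /=.
  apply/allP => _ /mapP[i hi ->]; apply/hz/mem_nth.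
  by move: hi (@pval_range n s i.+1); rewrite mem_iota sz; lia.
transitivity (shift_npart (size d) (stepsum d + size d * 0) x); last first.
  by rewrite muln0 addn0 sd cd.
(* Relabelling permutes the candidate columns, so they may be counted in the order of [s]. *)
rewrite -(@count_steps d 0 x B) // sd -[RHS](seq.permP permw) count_map.
apply: eq_in_count => z; rewrite mem_tuples => /andP[/eqP sz _] /=.
rewrite sumn_relabel // Des_addcol_nil // steps_iota ?size_relabel //; congr (_ && _).
clear d sd cd permw; case: n s sz sS => [|m] s sz sS //.
rewrite [RHS]/= add0n mem_filter mem_iota andbF leq0n /=.
apply: eq_in_all => i; rewrite mem_iota => hi; case: i hi => // i hi.
by rewrite [nth 0 (0 :: _) _]/= !nth_relabel //; lia.
Qed.

(** * Counting sorted lists *)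

Lemma mem_vecs k B s : (s \in vecs k B) = (size s == k) && all (fun x => x <= B) s.
Proof. by rewrite mem_tuples; congr (_ && _); apply: eq_all => x; exact: (mem_iota 0 B.+1 x). Qed.

Lemma unzip_addcol z S : size z = size S ->
  [seq head 0 v | v <- addcol z S] = z /\ [seq behead v | v <- addcol z S] = S.
Proof.
move=> sz; rewrite -!map_comp; split.
  by rewrite -[RHS](@unzip1_zip _ _ z S) ?sz //; apply: eq_map.
by rewrite -[RHS](@unzip2_zip _ _ z S) ?sz //; apply: eq_map.
Qed.

(** Cutting every row into head and tail inverts [addcol]. *)
Lemma perm_tuples_addcol n k B :
  perm_eq (tuples (seq nat) n (vecs k.+1 B))
          [seq addcol z Y | Y <- tuples (seq nat) n (vecs k B), z <- tuples nat n (iota 0 B.+1)].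
Proof.
apply: uniq_perm; first by do 2!apply: uniq_tuples; apply: iota_uniq.
  apply: allpairs_uniq; first by do 2!apply: uniq_tuples; apply: iota_uniq.
    by apply/uniq_tuples/iota_uniq.
  move=> p p' /allpairsP[[x y] /= [hx hy ->]] /allpairsP[[x' y'] /= [hx' hy' ->]].
  move: hx hx' hy hy'; rewrite !mem_tuples.
  move=> /andP[/eqP sx _] /andP[/eqP sx' _] /andP[/eqP sy _] /andP[/eqP sy' _] e.
  have [h1 h2] : _ /\ _ := @unzip_addcol y x (etrans sy (esym sx)).
  have [h1' h2'] : _ /\ _ := @unzip_addcol y' x' (etrans sy' (esym sx')).
  by move: e => /= e; congr pair; [rewrite -h2 e | rewrite -h1 e].
move=> T; apply/idP/allpairsP => [|[[S z] /= [hS hz ->]]].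
  rewrite mem_tuples => /andP[/eqP sT /allP hT].
  exists ([seq behead v | v <- T], [seq head 0 v | v <- T]); split => /=.
  - rewrite mem_tuples size_map sT eqxx; apply/allP => _ /mapP[v /hT hv ->].
    by move: hv; rewrite !mem_vecs; case: v => //= a v /andP[sv /andP[_ ->]]; rewrite -eqSS sv.
  - rewrite mem_tuples size_map sT eqxx; apply/allP => _ /mapP[v /hT hv ->].
    move: hv; rewrite mem_vecs; case: v => //= a v /andP[sv /andP[av _]].
    by rewrite -[0 :: _]/(iota 0 B.+1) mem_iota.
  - have : all (fun v => v != [::]) T.
      by apply/allP => v /hT; rewrite mem_vecs; case: v.
    by rewrite /addcol; elim: T {sT hT} => //= -[|a v] T IH //= /IH <-.
move: hS hz; rewrite !mem_tuples => /andP[/eqP sS /allP hS] /andP[/eqP sz /allP hz].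
rewrite size_map size_zip sS sz minnn eqxx; apply/(all_nthP [::]) => i.
rewrite size_map size_zip sS sz minnn => hi; rewrite nth_addcol ?sS ?sz //.
have h1 : nth [::] S i \in vecs k B by apply/hS/mem_nth; rewrite sS.
have h2 : nth 0 z i \in iota 0 B.+1 by apply/hz/mem_nth; rewrite sz.
rewrite mem_iota in h2; rewrite mem_vecs in h1; case/andP: h1 => h1 h3.
by rewrite mem_vecs /= eqSS h1 h3 andbT; lia.
Qed.

Lemma weightInf_addcol k z S : size z = size S ->
  weightInf k.+1 (addcol z S) = sumn z :: weightInf k S.
Proof.
move=> sz; have [h1 h2] := unzip_addcol sz; rewrite /weightInf /=; congr (_ :: _).
  by rewrite -{2}h1 sumnE big_map; apply: eq_bigr => v _; rewrite nth0.
rewrite (iotaDl 1 0) -map_comp; apply: eq_map => i /=; rewrite -{2}h2 big_map.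
by apply: eq_bigr => v _; rewrite nth_behead.
Qed.

(** The permutation is arbitrary because removing the first column replaces it by the one that sorts
    the remaining rows. *)
Definition sorted_count n R (s : 'S_n) (e : seq nat) (B : nat) : nat :=
  count (fun S => (Des n R S s == [::]) && (weightInf (size e) S == e))
        (tuples (seq nat) n (vecs (size e) B)).

Lemma tuples1 (T : Type) n (x : T) : tuples T n [:: x] = [:: nseq n x].
Proof. by elim: n => //= n ->. Qed.

Lemma sorted_count_nil n R (s : 'S_n) B :
  sorted_count R s [::] B = (Des n R (nseq n [::]) s == [::]).
Proof. by rewrite /sorted_count /vecs /= tuples1 /= andbT addn0. Qed.

Lemma countE (T : Type) (P : pred T) s : count P s = \sum_(x <- s) P x.
Proof. by rewrite -sum1_count big_mkcond. Qed.

Lemma sorted_count_cons n R (s : 'S_n) x e B : x <= B ->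
  sorted_count R s (x :: e) B =
  \sum_r shift_npart n (rcomaj r s) x * sorted_count R r e B.
Proof.
move=> xB; rewrite /sorted_count (seq.permP (perm_tuples_addcol _ _ _)) count_allpairs.
under [RHS]eq_bigr => r _ do rewrite countE big_distrr /=.
rewrite exchange_big; apply: eq_big_seq => S; rewrite mem_tuples => /andP[/eqP sS /allP hS].
have [|r rP] := @Des_rdes n R S (size e) sS.
  by apply/allP => v /hS; rewrite mem_vecs => /andP[].
(* Each [S] is sorted by exactly one permutation, so a single summand survives. *)
rewrite (bigD1 r) //= big1 ?addn0; last first.
  by move=> t tr; rewrite rP rdes_nil (negbTE tr) muln0.
rewrite rP rdes_nil eqxx /=.
transitivity (count (fun z => (Des n R (addcol z S) s == [::]) && (sumn z == x))
        (tuples nat n (iota 0 B.+1)) * (weightInf (size e) S == e)).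
  rewrite !countE big_distrl; apply: eq_big_seq => z; rewrite mem_tuples => /andP[/eqP sz _] /=.
  by rewrite weightInf_addcol ?sz ?sS // eqseq_cons mulnb andbA.
by rewrite count_addcol // /rcomaj -rP.
Qed.

(** The recursion of [sorted_count_cons] freed from [R] and the bound; [t] stands for the
    permutation that sorts the empty rows. *)
Fixpoint sorted_coef n (t s : 'S_n) (e : seq nat) : nat :=
  if e is x :: e' then \sum_r shift_npart n (rcomaj r s) x * sorted_coef t r e'
  else s == t.

Lemma sorted_countE n R (t s : 'S_n) e B : Des n R (nseq n [::]) t = [::] -> sumn e <= B ->
  sorted_count R s e B = sorted_coef t s e.
Proof.
move=> ht; elim: e s => [|x e IH] s /= hB.
  rewrite sorted_count_nil.
  have [||r rP] := @Des_rdes n R (nseq n [::]) 0; rewrite ?size_nseq //.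
    by apply/allP => v /nseqP[->].
  by move/eqP: ht; rewrite !rP !rdes_nil => /eqP->.
rewrite sorted_count_cons; last by lia.
by apply: eq_bigr => r _; rewrite IH //; lia.
Qed.

(** The recursion of [sorted_coef] with each series q^c/(q;q)_n replaced by its numerator q^c. *)
Fixpoint path_count n (t s : 'S_n) (e : seq nat) : nat :=
  if e is x :: e' then \sum_r (x == rcomaj r s) * path_count t r e' else s == t.

(** * Clearing the denominators *)

Import GRing.Theory.
Local Open Scope ring_scope.

(** The coefficient of q^x in the product of [p] with the power series whose coefficients are
    [f]. *)
Definition cauchy (p : {poly int}) (f : nat -> int) (x : nat) : int :=
  \sum_(j < x.+1) p`_j * f (x - j)%N.

(** Truncating the series above [x] makes the product one of polynomials. *)
Lemma cauchyE p f x B : (x < B)%N -> cauchy p f x = (p * \poly_(i < B) f i)`_x.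
Proof.
move=> xB; rewrite coefM; apply: eq_bigr => j _; rewrite coef_poly ifT //.
by apply: leq_ltn_trans (leq_subr _ _) xB.
Qed.

Lemma cauchyM p q f x : cauchy (p * q) f x = cauchy p (cauchy q f) x.
Proof.
rewrite (@cauchyE _ _ _ x.+1) // -mulrA coefM; apply: eq_bigr => j _.
by rewrite -cauchyE // ltnS leq_subr.
Qed.

Lemma eq_cauchy p f g x : f =1 g -> cauchy p f x = cauchy p g x.
Proof. by move=> fg; apply: eq_bigr => j _; rewrite fg. Qed.

(** The last factor of (q;q)_(n+1) lowers [npart n.+1] to [npart n] by [npart_rec]; the other
    factors are removed by induction. *)
Lemma cauchy_npart n x : cauchy (qqn n) (fun y => (npart n y)%:Z) x = (x == 0)%:Z.
Proof.
elim: n x => [|n IH] x.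
  by rewrite (@cauchyE _ _ _ x.+1) // /qqn /qpoch big_ord0 mul1r coef_poly ltnSn.
rewrite /qqn /qpoch big_ord_recr cauchyM -IH; apply: eq_cauchy => y.
rewrite (@cauchyE _ _ _ y.+1) // -exprS mulrBl mul1r coefB coefXnM !coef_poly ltnSn.
rewrite npart_rec (leqNgt n.+1 y); case: (ltnP y n.+1) => h.
  by rewrite addn0 subr0.
by rewrite ltnS leq_subr PoszD addrK.
Qed.

Lemma cauchy_shift_npart n c x :
  cauchy (qqn n) (fun y => (shift_npart n c y)%:Z) x = (x == c)%:Z.
Proof.
have [cx|xc] := leqP c x; last first.
  rewrite /cauchy big1 ?ltn_eqF // => j _; rewrite /shift_npart leqNgt.
  by rewrite (leq_ltn_trans (leq_subr _ _) xc) mulr0.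
have -> : (x == c) = (x - c == 0)%N by rewrite subn_eq0 eqn_leq cx andbT.
rewrite -(cauchy_npart n) /cauchy.
rewrite -(big_mkord xpredT (fun j => (qqn n)`_j * (shift_npart n c (x - j))%:Z)).
rewrite -(big_mkord xpredT (fun j => (qqn n)`_j * (npart n (x - c - j))%:Z)).
rewrite (big_cat_nat (n := (x - c).+1)) //; last by rewrite ltnS leq_subr.
rewrite [LHS]/= [X in _ + X = _]big_nat_cond [X in _ + X = _]big1; last first.
  by move=> j; rewrite andbT => hj; rewrite /shift_npart ifF ?mulr0 //; lia.
rewrite addr0; apply: eq_big_nat => j hj; rewrite /shift_npart ifT; last by lia.
by rewrite subnAC.
Qed.

Lemma conv_nil n L : conv n [::] L = (L [::])%:Z.
Proof. by rewrite /conv /= big_seq1 /dencoef big_nil mul1r. Qed.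

Lemma conv_cons n x e L :
  conv n (x :: e) L = \sum_(y < x.+1) (qqn n)`_y * conv n e (fun e' => L ((x - y)%N :: e')).
Proof.
rewrite /conv -[boxes (x :: e)]/[seq y :: a | y <- iota 0 x.+1, a <- boxes e].
rewrite big_allpairs_dep -[iota 0 x.+1]/(index_iota 0 x.+1) big_mkord.
apply: eq_bigr => y _; rewrite big_distrr /=; apply: eq_bigr => a _.
by rewrite /dencoef big_cons mulrA.
Qed.

Lemma conv_sum n e (I : finType) (c : I -> nat) (L : I -> seq nat -> nat) :
  conv n e (fun e' => (\sum_i c i * L i e')%N) = \sum_i (c i)%:Z * conv n e (L i).
Proof.
rewrite /conv; under [RHS]eq_bigr => i _ do rewrite big_distrr.
rewrite exchange_big; apply: eq_bigr => a _ /=.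
rewrite -natz natr_sum big_distrr; apply: eq_bigr => i _ /=.
by rewrite natrM mulrCA !natz.
Qed.

(** The denominators are cleared one variable at a time, each by [cauchy_shift_npart]. *)
Lemma conv_sorted_coef n (t s : 'S_n) e :
  conv n e (sorted_coef t s) = (path_count t s e)%:Z.
Proof.
elim: e s => [|x e IH] s; first by rewrite conv_nil.
rewrite conv_cons /=.
under eq_bigr => y _ do rewrite conv_sum big_distrr.
rewrite exchange_big -natz natr_sum; apply: eq_bigr => r _ /=.
rewrite natrM !natz -IH -(cauchy_shift_npart n) /cauchy big_distrl.
by apply: eq_bigr => y _; rewrite mulrA.
Qed.

Lemma eq_conv n e L L' : (forall e', size e' = size e -> L e' = L' e') ->
  conv n e L = conv n e L'.
Proof.
elim: e L L' => [|x e IH] L L' h; first by rewrite !conv_nil h.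
rewrite !conv_cons; apply: eq_bigr => y _; congr (_ * _); apply: IH => e' se.
by apply: h; rewrite /= se.
Qed.

Local Close Scope ring_scope.

(** * The two sides as path counts *)

Lemma Fchain_Des n R S k : size S = n -> all (fun s => size s == k) S ->
  Fchain R S = (Des n R S 1%g == [::]).
Proof.
move=> sS szk; rewrite DesE.
have E i : i \in iota 1 n.-1 -> ~~ bef R S (pval n 1%g i.+1) (pval n 1%g i) =
    (if i \in R then lexlt (nth [::] S i.-1) (nth [::] S i)
     else lexle (nth [::] S i.-1) (nth [::] S i)).
  rewrite mem_iota => hi; rewrite !pval1; try lia.
  have -> : ~~ bef R S i.+1 i = bef R S i i.+1.
    apply/idP/idP => [h|h]; last by apply/negP => /(bef_trans h); rewrite bef_irr.
    have : bef R S i i.+1 || bef R S i.+1 i by apply: (@bef_total R S k); lia.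
    by rewrite (negbTE h) orbF.
  (* Adjacent labels [i] and [i.+1] are equivalent exactly when [i] lies in [R], so a tie favours
     [i] exactly when it does not. *)
  have -> : bef R S i i.+1 = lexlt (nth [::] S i.-1) (nth [::] S i)
      || ((nth [::] S i.-1 == nth [::] S i) && (i \notin R)).
    rewrite /bef /tie /simR /= ltnSn ltnNge leqnSn /= orbF.
    by rewrite (minn_idPl (leqnSn i)) (maxn_idPr (leqnSn i)) subSnn /= andbT neq_ltn ltnSn.
  by rewrite /lexle; case: (i \in R); rewrite ?andbF ?orbF ?andbT // orbC.
rewrite /Fchain sS; apply/allP/filter_nilP => h i hi; first by rewrite E // h.
by rewrite -E // h.
Qed.

Lemma lhsBE n R t e : Des n R (nseq n [::]) t = [::] -> lhsB n R e = sorted_coef t 1%g e.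
Proof.
move=> ht; rewrite -(sorted_countE _ ht (leqnn _)); apply: eq_in_count => S.
rewrite mem_tuples => /andP[/eqP sS /allP hS]; rewrite (@Fchain_Des n R S (size e)) //.
by apply/allP => v /hS; rewrite mem_vecs => /andP[].
Qed.

(** The most significant coordinate carries q_k in (a) but q_1 in (b). *)
Lemma weightA_rev k S : weightA k S = rev (weightInf k S).
Proof.
apply: (@eq_from_nth _ 0); rewrite ?size_rev !size_map !size_iota // => i hi.
rewrite nth_rev ?size_map ?size_iota // !(nth_map 0) ?size_iota ?nth_iota //; lia.
Qed.

Lemma lhsA_rev n k R e : size e = k -> lhsA n k R e = lhsB n R (rev e).
Proof.
move=> se; rewrite /lhsA /lhsB size_rev se sumn_rev; apply: eq_count => S.
by rewrite weightA_rev (can2_eq revK revK).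
Qed.

Lemma mem_boxes e a : (a \in boxes e) = (size a == size e) && all (fun x => x.1 <= x.2) (zip a e).
Proof.
elim: e a => [|x e IH] [|y a] //.
  by apply/allpairsP => -[[? ?] /= []].
rewrite -[boxes (x :: e)]/[seq y :: a | y <- iota 0 x.+1, a <- boxes e].
rewrite [RHS]/= eqSS andbCA -IH; apply/allpairsP/andP => [[[u v] [hu hv [-> ->]]]|[yx ha]].
  by rewrite mem_iota in hu.
by exists (y, a); rewrite mem_iota ltnS.
Qed.

Lemma uniq_boxes e : uniq (boxes e).
Proof.
elim: e => // x e IH; apply: allpairs_uniq => //; first exact: iota_uniq.
by move=> [a s] [b u] _ _ /= [-> ->].
Qed.

Lemma perm_boxes_rev e : perm_eq (boxes (rev e)) [seq rev a | a <- boxes e].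
Proof.
apply: uniq_perm; rewrite ?(map_inj_uniq (can_inj revK)) ?uniq_boxes // => a.
rewrite -[a]revK (mem_map (can_inj revK)) !mem_boxes !size_rev.
by case: eqP => //= sa; rewrite -rev_zip ?size_rev // all_rev.
Qed.

Local Open Scope ring_scope.

Lemma conv_rev n e L : conv n e (fun a => L (rev a)) = conv n (rev e) L.
Proof.
rewrite /conv (perm_big _ (perm_boxes_rev e)) big_map; apply: eq_big_seq => a.
rewrite mem_boxes => /andP[/eqP sa _]; congr (_ * _).
  by rewrite /dencoef (perm_big _ (permEl (perm_rev a))).
by rewrite -map_rev rev_zip.
Qed.

Local Close Scope ring_scope.

(** * Chains of relative comajor indices *)

Fixpoint chain_comajs n (t : 'S_n) (ps : seq 'S_n) : seq nat :=
  if ps is p :: ps' then rcomaj t p :: chain_comajs p ps' else [::].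

(** The prepended descent counts rise exactly at the descents of [s], as [Des_addcol_nil] demands,
    so the new list is sorted by [s]; later descents are relative to [s] alone. *)
Lemma Des_Zmap n R (s : 'S_n) S k : size S = n -> all (fun v => size v == k) S ->
  (forall t, Des n R (Zmap n R s S) t = rdes s t)
  /\ size (Zmap n R s S) = n /\ all (fun v => size v == k.+1) (Zmap n R s S).
Proof.
move=> sS hS.
have sZ : size (Zmap n R s S) = n by rewrite size_map size_iota.
have hZ : all (fun v => size v == k.+1) (Zmap n R s S).
  apply/allP => _ /mapP[j hj ->]; rewrite /= eqSS.
  by apply: (allP hS); apply: mem_nth; move: hj; rewrite mem_iota sS; lia.
split; last by split.
have [r rP] := Des_rdes R sZ hZ.
suff : Des n R (Zmap n R s S) s == [::] by rewrite rP rdes_nil => /eqP sr t; rewrite rP -sr.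
pose z := [seq count (fun d => d < pval n s^-1%g j) (Des n R S s) | j <- iota 1 n].
have sz : size z = n by rewrite size_map size_iota.
have nz i : 0 < i <= n -> nth 0 z (pval n s i).-1 = count (fun d => d < i) (Des n R S s).
  move=> hi; have h := pval_range s hi; rewrite (nth_map 0) ?size_iota ?nth_iota; try lia.
  by rewrite add1n prednK ?pvalK //; lia.
have -> : Zmap n R s S = addcol z S.
  apply: (@eq_from_nth _ [::]); first by rewrite sZ size_map size_zip sz sS minnn.
  rewrite sZ => i hi; rewrite nth_addcol ?sz ?sS // !(nth_map 0) ?size_iota //.
  by rewrite nth_iota.
rewrite Des_addcol_nil //; apply/allP => i; rewrite mem_iota => hi; rewrite !nz; try lia.
(* The descents below [i], together with [i] if it is one, are the descents below [i.+1]. *)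
have -> : (i \in Des n R S s : nat) = count (pred1 i) (Des n R S s).
  by rewrite count_uniq_mem // filter_uniq // iota_uniq.
rewrite -count_predUI [X in _ + X](eq_count (a2 := pred0)) ?count_pred0 ?addn0.
  by apply: sub_count => d /=; lia.
by move=> d /=; lia.
Qed.

Lemma comaj_auxE n R k Z (t : 'S_n) ps : size Z = n -> all (fun v => size v == k) Z ->
  (forall s, Des n R Z s = rdes t s) -> comaj_aux n R Z ps = chain_comajs t ps.
Proof.
elim: ps k Z t => //= p ps IH k Z t sZ hZ hD.
have [h1 [h2 h3]] := Des_Zmap R p sZ hZ.
by rewrite (IH _ _ _ h2 h3 h1) /Comaj hD.
Qed.

Lemma Comaj_eq0 n R S (s : 'S_n) : (Comaj n R S s == 0) = (Des n R S s == [::]).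
Proof.
rewrite /Comaj; apply/eqP/eqP => [|->]; last by rewrite big_nil.
case E: (Des n R S s) => [|i D] //; rewrite big_cons => h.
have : i \in Des n R S s by rewrite E mem_head.
by rewrite mem_filter mem_iota; lia.
Qed.

(** The permutation sorting the empty rows is the only one with comajor index 0, so the choice in
    [tauR] succeeds and returns it. *)
Lemma tauR_rdes n R s : Des n R (nseq n [::]) s = rdes (tauR n R) s.
Proof.
have [||r rP] := @Des_rdes n R (nseq n [::]) 0; rewrite ?size_nseq //.
  by apply/allP => v /nseqP[->].
rewrite /tauR; case: pickP => [t|/(_ r)]; rewrite Comaj_eq0 rP rdes_nil ?eqxx //.
by move=> /eqP->; rewrite rP.
Qed.

Lemma comajsE n R (pis : seq 'S_n) : comajs n R pis = chain_comajs (tauR n R) (rcons pis 1%g).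
Proof.
apply: (@comaj_auxE n R 0); rewrite ?size_nseq //; last exact: tauR_rdes.
by apply/allP => v /nseqP[->].
Qed.

(** [ps] lists the vertices after [s], and [e] the weights of the edges; the two lengths are kept
    equal. *)
Fixpoint is_path n (t s : 'S_n) (ps : seq 'S_n) (e : seq nat) : bool :=
  match ps, e with
  | p :: ps', x :: e' => (x == rcomaj p s) && is_path t p ps' e'
  | _, _ => s == t
  end.

Lemma path_countE n (t s : 'S_n) e :
  path_count t s e = count (fun ps => is_path t s ps e) (tuples 'S_n (size e) (enum 'S_n)).
Proof.
elim: e s => [|x e IH] s; first by rewrite /= addn0.
rewrite -[size (x :: e)]/(size e).+1 count_tuplesS big_enum /=; apply: eq_bigr => r _.
rewrite IH; case: (_ == _); rewrite ?mul1n ?mul0n //=.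
by elim: (tuples _ _ _).
Qed.

Lemma chain_comajs_rcons n (t s : 'S_n) ps :
  chain_comajs t (rcons ps s) = rcons (chain_comajs t ps) (rcomaj (last t ps) s).
Proof. by elim: ps t => //= p ps IH t; rewrite IH. Qed.

Fixpoint rev_chain n (t s : 'S_n) (qs : seq 'S_n) : seq nat :=
  if qs is q :: qs' then rcomaj q s :: rev_chain t q qs' else [:: rcomaj t s].

Lemma chain_comajs_rev n (t s : 'S_n) qs :
  chain_comajs t (rcons (rev qs) s) = rev (rev_chain t s qs).
Proof.
elim: qs s => //= q qs IH s.
by rewrite rev_cons chain_comajs_rcons last_rcons IH rev_cons.
Qed.

(** The last vertex of a path is forced to be [t], so k weights leave k-1 free permutations. *)
Lemma count_rev_chain n (t s : 'S_n) x e :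
  count (fun qs => rev_chain t s qs == x :: e) (tuples 'S_n (size e) (enum 'S_n))
  = path_count t s (x :: e).
Proof.
elim: e x s => [|y e IH] x s.
  rewrite /= (bigD1 t) //= big1 => [|r /negbTE->]; last by rewrite muln0.
  by rewrite eqxx muln1 !addn0 eqseq_cons andbT eq_sym.
rewrite -[size (y :: e)]/(size e).+1 count_tuplesS big_enum.
rewrite -[RHS]/(\sum_r (x == rcomaj r s) * path_count t r (y :: e)); apply: eq_bigr => r _.
rewrite -IH [x == _]eq_sym; under eq_count => qs do rewrite [rev_chain _ _ _]/= eqseq_cons.
case: (rcomaj r s == x) => /=; first by rewrite mul1n.
by elim: (tuples _ _ _).
Qed.

Lemma numAE n k R e : 0 < k -> size e = k -> numA n k R e = path_count (tauR n R) 1%g (rev e).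
Proof.
case: k => // k _ se; rewrite /numA /=.
have permr : perm_eq [seq rev qs | qs <- tuples 'S_n k (enum 'S_n)] (tuples 'S_n k (enum 'S_n)).
  apply: perm_map_endo; first exact/uniq_tuples/enum_uniq.
    by move=> x y _ _; apply: (can_inj revK).
  by move=> x; rewrite !mem_tuples size_rev all_rev.
(* [comajs] runs from [tauR] to the identity and [path_count] the other way, so tuples and exponents
   are both reversed. *)
rewrite -(seq.permP permr) count_map.
have : size (rev e) = k.+1 by rewrite size_rev.
case E: (rev e) => [|x e'] //= [<-]; rewrite -[RHS]/(path_count _ _ (x :: e')) -count_rev_chain.
by apply: eq_count => qs; rewrite /= comajsE chain_comajs_rev (can2_eq revK revK) E.
Qed.

Lemma conv_lhsA n k R e : 0 < k -> size e = k -> conv n e (lhsA n k R) = Posz (numA n k R e).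
Proof.
move=> k0 se; rewrite numAE // -conv_sorted_coef -conv_rev; apply: eq_conv => a sa.
rewrite lhsA_rev ?sa //; apply: lhsBE.
by apply/eqP; rewrite tauR_rdes rdes_nil.
Qed.

Lemma conv_lhsB n R e : conv n e (lhsB n R) = Posz (path_count (tauR n R) 1%g e).
Proof.
rewrite -conv_sorted_coef; apply: eq_conv => a _; apply: lhsBE.
by apply/eqP; rewrite tauR_rdes rdes_nil.
Qed.

(** * Infinite sequences of permutations *)

Lemma rcomaj_eq0 n (r s : 'S_n) : (rcomaj r s == 0) = (s == r).
Proof.
rewrite -rdes_nil /rcomaj; apply/eqP/eqP => [|->]; last by rewrite big_nil.
case E: (rdes r s) => [|i D] //; rewrite big_cons => h.
have : i \in rdes r s by rewrite E mem_head.
by rewrite mem_filter mem_iota; lia.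
Qed.

(** The default [t] continues the path constantly with weight 0; the equation at [i = size e] says
    that the path ends in [t]. *)
Lemma is_pathP n (t s : 'S_n) ps e : size ps = size e ->
  reflect (forall i, rcomaj (nth t ps i) (nth t (s :: ps) i) = nth 0 e i)
          (is_path t s ps e).
Proof.
elim: e s ps => [|x e IH] s [|p ps] //= sz.
  apply: (iffP eqP) => [-> [|i]|/(_ 0) /eqP]; rewrite ?nth_nil /=.
  - by apply/eqP; rewrite rcomaj_eq0.
  - by apply/eqP; rewrite nth_nil rcomaj_eq0.
  - by rewrite rcomaj_eq0 => /eqP.
case: sz => sz; apply: (iffP andP) => [[/eqP -> /(IH _ _ sz) h] [|i] //=|h].
split; first by rewrite -[x]/(nth 0 (x :: e) 0) -h.
by apply/(IH _ _ sz) => i; apply: (h i.+1).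
Qed.

Lemma nth_chain_comajs n (t : 'S_n) ps i : i < size ps ->
  nth 0 (chain_comajs t ps) i = rcomaj (nth t (t :: ps) i) (nth t ps i).
Proof.
elim: ps t i => // p ps IH t [|i] //= hi; rewrite IH //.
by congr rcomaj; [apply: (@set_nth_default _ (p :: ps)); rewrite /= ltnW | apply: set_nth_default].
Qed.

Lemma nth_ComajExp n R (s : nat -> 'S_n) m i : 0 < m -> s 0 = 1%g ->
  (forall j, m <= j -> s j = tauR n R) ->
  nth 0 (ComajExp n R s m) i = rcomaj (s i.+1) (s i).
Proof.
move=> m0 s0 hm; rewrite /ComajExp.
have [hi|hi] := ltnP i m; last first.
  rewrite nth_default ?size_map ?size_iota // !hm //; last by lia.
  by apply/esym/eqP; rewrite rcomaj_eq0.
rewrite (nth_map 0) ?size_iota // nth_iota // comajsE.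
(* The appended identity is [s 0]. *)
have -> : rcons (rev [seq s i | i <- iota 1 m.-1]) 1%g = rev [seq s i | i <- iota 0 m].
  by case: m m0 {hm hi} => // m _; rewrite /= rev_cons s0.
have nthr j : j < m -> nth (tauR n R) (rev [seq s i | i <- iota 0 m]) j = s (m - j.+1).
  move=> hj; rewrite nth_rev size_map size_iota // (nth_map 0) ?size_iota; last by lia.
  by rewrite nth_iota //; lia.
rewrite nth_chain_comajs ?size_rev ?size_map ?size_iota; last by lia.
rewrite nthr; last by lia.
congr rcomaj; last by congr s; lia.
(* At index 0 the predecessor is the start [tauR] of the chain, which equals [s m]. *)
case E: (m - (1 + i)) => [|j] /=; first by rewrite hm //; lia.
by rewrite nthr; [congr s|]; lia.
Qed.

Lemma monoeqP a b : reflect (forall i, nth 0 a i = nth 0 b i) (monoeq a b).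
Proof.
apply: (iffP allP) => [h i|h i _]; last by rewrite h.
have [hi|hi] := ltnP i (maxn (size a) (size b)).
  by apply/eqP/h; rewrite mem_iota.
by rewrite !nth_default //; lia.
Qed.

Lemma fiberBP n R e (s : nat -> 'S_n) :
  fiberB n R e s <->
  RSinf n R s /\ forall i, rcomaj (s i.+1) (s i) = nth 0 e i.
Proof.
split=> [[rs [m [[m0 [hm _]] /monoeqP h]]]|[rs h]]; split=> //.
  by move=> i; rewrite -h nth_ComajExp //; case: rs.
have [s0 [M hM]] := rs.
(* Only indices below [M] need checking, which makes the condition on [m] boolean and yields a least
   one. *)
pose P m := (0 < m) && all (fun j => s j == tauR n R) (iota m (M - m)).
have PP m : reflect (0 < m /\ forall j, m <= j -> s j = tauR n R) (P m).
  apply: (iffP andP) => -[m0 hm]; split=> //.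
    move=> j mj; have [Mj|jM] := leqP M j; first exact: hM.
    by apply/eqP/(allP hm); rewrite mem_iota; lia.
  by apply/allP => j; rewrite mem_iota => hj; rewrite hm //; lia.
have exP : exists m, P m.
  by exists M.+1; apply/PP; split=> // j hj; apply: hM; lia.
have [m /PP [m0 hm] min] := ex_minnP exP.
exists m; split; last by apply/monoeqP => i; rewrite nth_ComajExp.
by split=> //; split=> // m' m'0 hm'; apply/min/PP.
Qed.

(** Functions [nat -> 'S_n] carry no boolean equality, so membership is pulled back to the lists
    encoding them. *)
Lemma In_map_mem (A : eqType) B (f : A -> B) (l : seq A) y :
  List.In y (map f l) <-> exists2 x, x \in l & y = f x.
Proof.
elim: l => [|a l IH] /=; first by split=> // -[].
rewrite IH; split=> [[<-|[x xl ->]]|[x]].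
- by exists a; rewrite ?mem_head.
- by exists x; rewrite ?inE ?xl ?orbT.
- by rewrite inE => /orP[/eqP->|xl] ->; [left|right; exists x].
Qed.

Lemma NoDup_map_uniq (A : eqType) B (f : A -> B) (l : seq A) :
  uniq l -> {in l &, injective f} -> List.NoDup (map f l).
Proof.
elim: l => [|a l IH] /=; first by constructor.
move=> /andP[al ul] fi; constructor.
  rewrite In_map_mem => -[x xl e]; move: al.
  by rewrite (fi _ _ (mem_head _ _) _ e) ?xl // inE xl orbT.
by apply: IH => // x y xl yl; apply: fi; rewrite inE ?xl ?yl orbT.
Qed.

Lemma fiberB_enum n R e : exists fs : list (nat -> 'S_n),
  List.NoDup fs /\ (forall s, List.In s fs <-> fiberB n R e s) /\
  List.length fs = path_count (tauR n R) 1%g e.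
Proof.
(* A path is turned into a sequence that starts at the identity and continues with [t] forever. *)
set t := tauR n R; pose seqfun ps i := nth t (1%g :: ps) i.
pose l := [seq ps <- tuples 'S_n (size e) (enum 'S_n) | is_path t 1%g ps e].
have memlP ps : ps \in l -> size ps = size e /\
    forall i, rcomaj (seqfun ps i.+1) (seqfun ps i) = nth 0 e i.
  by rewrite mem_filter mem_tuples => /and3P[h /eqP sz _]; split=> //; apply/is_pathP.
exists (map seqfun l); split; [|split].
- apply: NoDup_map_uniq; first exact/filter_uniq/uniq_tuples/enum_uniq.
  move=> x y /memlP[sx _] /memlP[sy _] exy; apply: (@eq_from_nth _ t); first by rewrite sx.
  by move=> i _; apply: (congr1 (fun g => g i.+1) exy).
- move=> s; rewrite In_map_mem fiberBP; split=> [[ps /memlP[sz h] ->]|[[s0 [M hM]] h]].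
    split=> //; split=> //; exists (size e).+1 => -[//|i] hi.
    by rewrite /seqfun /= nth_default // sz.
  (* Beyond [size e] all exponents are 0, so consecutive permutations agree and the eventual value
     [t] already holds from [size e] on. *)
  have st i : size e <= i -> s i = t.
    move=> hi; have <- : s (i + M) = t by apply: hM; rewrite leq_addl.
    elim: M {hM} => [|M IH]; first by rewrite addn0.
    by rewrite addnS IH; apply/eqP; rewrite -rcomaj_eq0 h nth_default //; lia.
  pose ps := [seq s i | i <- iota 1 (size e)].
  have es : s = seqfun ps.
    apply: functional_extensionality => -[//|i]; rewrite /seqfun /=.
    have [hi|hi] := ltnP i (size e); first by rewrite (nth_map 0) ?size_iota // nth_iota.
    by rewrite nth_default ?size_map ?size_iota // st // ltnW.
  exists ps => //; rewrite mem_filter mem_tuples size_map size_iota eqxx /=.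
  apply/andP; split; last by apply/allP => x _; rewrite /= mem_enum.
  by apply/is_pathP => [|i]; [rewrite size_map size_iota | rewrite -h es].
- by rewrite path_countE -size_filter -/l -(size_map seqfun); elim: (map _ _) => //= ? ? ->.
Qed.

Theorem theorem8 (n : nat) (R : seq nat) :
  1 <= n -> (forall i, i \in R -> 0 < i < n) ->
  (forall (k : nat) (e : seq nat), 1 <= k -> size e = k ->
     conv n e (lhsA n k R) = Posz (numA n k R e))
  /\
  (forall e : seq nat, exists fs : list (nat -> 'S_n),
     List.NoDup fs /\ (forall s, List.In s fs <-> fiberB n R e s) /\
     Posz (List.length fs) = conv n e (lhsB n R)).
Proof.
move=> _ _; split=> [k e|e]; first exact: conv_lhsA.
have [fs [nd [mem len]]] := fiberB_enum n R e.
by exists fs; rewrite conv_lhsB len.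
Qed.
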